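(* Let $L_1$ be the 3-dimensional complex $\omega$-Lie algebra with basis $\{x,y,z\}$, bracket determined by $[x,z]=0$, $[y,z]=z$, $[x,y]=y$, and form $\omega$ determined by $\omega(y,z)=\omega(x,z)=0$, $\omega(x,y)=1$. Then: (1) $\mathrm{Der}(L_1)$ is a 2-dimensional soluble, but not nilpotent, Lie algebra. (2) $\mathrm{Der}_{\omega}(L_1)=\mathrm{Der}(L_1)$.
   Context: An $\omega$-Lie algebra over $\mathbb{C}$ is a triple $(\mathfrak{g},[-,-],\omega)$ where $\mathfrak{g}$ is a finite-dimensional complex vector space, $[-,-]$ is a skew-symmetric bilinear bracket on $\mathfrak{g}$ and $\omega:\mathfrak{g}\times\mathfrak{g}\to\mathbb{C}$ is a skew-symmetric bilinear form such that $$[[x,y],z]+[[y,z],x]+[[z,x],y]=\omega(x,y)z+\omega(y,z)x+\omega(z,x)y$$ for all $x,y,z\in\mathfrak{g}$. A derivation of $\mathfrak{g}$ is a linear map $d:\mathfrak{g}\to\mathfrak{g}$ with $d([x,y])=[d(x),y]+[x,d(y)]$ for all $x,y\in\mathfrak{g}$. $\mathrm{Der}(\mathfrak{g})$ is the Lie algebra of all derivations, a Lie subalgebra of $\mathfrak{gl}(\mathfrak{g})$ under the commutator. $\mathrm{Der}_{\omega}(\mathfrak{g})$ is the set of those $d\in\mathrm{Der}(\mathfrak{g})$ with $\omega(d(x),y)+\omega(x,d(y))=0$ for all $x,y\in\mathfrak{g}$. *)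

(* Defs.v *)
From HB Require Import structures.
From mathcomp Require Import all_boot all_order all_algebra.
From mathcomp Require Import ring.
From mathcomp Require Import reals.
From mathcomp Require Export complex.

Set Implicit Arguments.
Unset Strict Implicit.
Unset Printing Implicit Defensive.

Import GRing.Theory.
Local Open Scope ring_scope.

Record omegaLieAlg (K : fieldType) := OmegaLieAlg {
  omega_sort :> vectType K;
  obr : {bilinear omega_sort -> omega_sort -> omega_sort};
  om : {biscalar omega_sort};
  obr_skew : forall x y, obr x y = - obr y x;
  om_skew : forall x y, om x y = - om y x;
  omega_jacobi : forall x y z,
    obr (obr x y) z + obr (obr y z) x + obr (obr z x) y
    = om x y *: z + om y z *: x + om z x *: y }.

Record lieAlg (K : fieldType) := LieAlg {
  lie_sort :> vectType K;
  lbr : {bilinear lie_sort -> lie_sort -> lie_sort};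
  lbr_alt : forall x, lbr x x = 0;
  lie_jacobi : forall x y z,
    lbr (lbr x y) z + lbr (lbr y z) x + lbr (lbr z x) y = 0 }.

Arguments obr {K o}.
Arguments om {K o}.
Arguments lbr {K l}.

Section LieSubspaces.
Variables (K : fieldType) (L : lieAlg K).
Implicit Types U W X : {vspace L}.

(* As for prodv in falgebra, bases suffice to span all brackets: see
   lie_prodP. *)
Definition lie_prod U W : {vspace L} :=
  <<[seq lbr u w | u <- vbasis U, w <- vbasis W]>>%VS.

Lemma mem_lie_prod U W u w : u \in U -> w \in W -> lbr u w \in lie_prod U W.
Proof.
move=> /coord_vbasis -> /coord_vbasis ->.
rewrite linear_sumlz; apply: memv_suml => i _.
rewrite linear_sumr; apply: memv_suml => j _ /=.
rewrite linearZr_LR linearZl_LR /=; do 2!apply: memvZ.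
by apply/memv_span/allpairs_f; apply/mem_nth; rewrite size_tuple.
Qed.

Lemma lie_prodP U W X :
  (lie_prod U W <= X)%VS <->
  (forall u w, u \in U -> w \in W -> lbr u w \in X).
Proof.
split=> [/subvP sX u w uU wW|H]; first by apply/sX/mem_lie_prod.
apply/span_subvP => _ /allpairsP[[u w] /= [uU wW ->]].
by apply: H; apply: vbasis_mem.
Qed.

Definition lie_subalgebra U : Prop :=
  forall u v, u \in U -> v \in U -> lbr u v \in U.

Definition derived_series U (k : nat) : {vspace L} :=
  iter k (fun W => lie_prod W W) U.

Definition lower_central_series U (k : nat) : {vspace L} :=
  iter k (fun W => lie_prod U W) U.

(* Meaningful when U is a subalgebra of L, viewed as a Lie algebra. *)
Definition soluble U : Prop := exists k, derived_series U k = 0%VS.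

Definition nilpotent U : Prop := exists k, lower_central_series U k = 0%VS.

End LieSubspaces.

Section Gl.
Variables (K : fieldType) (V : vectType K).

(* \o and - have the same precedence, hence the parentheses. *)
Definition commutator (f g : 'End(V)) : 'End(V) := (f \o g)%VF - (g \o f)%VF.

Lemma commutator_bilinear : bilinear_for *:%R *:%R commutator.
Proof.
split=> f a u v /=; rewrite /commutator.
- rewrite comp_lfunDl comp_lfunDr -comp_lfunZl -comp_lfunZr scalerBr.
  by rewrite opprD addrACA.
- rewrite comp_lfunDl comp_lfunDr -comp_lfunZl -comp_lfunZr scalerBr.
  by rewrite opprD addrACA.
Qed.

HB.instance Definition _ :=
  bilinear_isBilinear.Build K 'End(V) 'End(V) 'End(V) *:%R *:%R commutator
    commutator_bilinear.

Lemma commutator_alt f : commutator f f = 0.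
Proof. exact: subrr. Qed.

Lemma commutator_jacobi f g h :
  commutator (commutator f g) h + commutator (commutator g h) f
  + commutator (commutator h f) g = 0.
Proof.
rewrite /commutator !(comp_lfunDl, comp_lfunDr, comp_lfunNl, comp_lfunNr).
rewrite !comp_lfunA !opprD !opprK !addrA.
rewrite [LHS](ACl ((1*7)*(12*2)*(9*3)*(4*6)*(5*11)*(8*10))%AC).
by rewrite /= !subrr !addr0.
Qed.

Definition gl : lieAlg K := LieAlg commutator_alt commutator_jacobi.

End Gl.

Section Derivations.
Variables (K : fieldType) (g : omegaLieAlg K).

Definition is_derivation (d : 'End(g)) : Prop :=
  forall x y, d (obr x y) = obr (d x) y + obr x (d y).

Definition preserves_om (d : 'End(g)) : Prop :=
  forall x y, om (d x) y + om x (d y) = 0.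

Definition der_defect (x y : g) (d : 'End(g)) : g :=
  d (obr x y) - (obr (d x) y + obr x (d y)).

Lemma der_defect_linear x y : linear (der_defect x y).
Proof.
move=> a d e; rewrite /der_defect !add_lfunE !scale_lfunE.
rewrite linearPl linearPr /= scalerBr scalerDr.
by rewrite [in RHS]addrACA -opprD; congr (_ - _); rewrite addrACA.
Qed.

HB.instance Definition _ x y :=
  GRing.isLinear.Build K 'End(g) g *:%R (der_defect x y)
    (der_defect_linear x y).

Definition om_defect (x y : g) (d : 'End(g)) : K^o := om (d x) y + om x (d y).

Lemma om_defect_linear x y : linear (om_defect x y).
Proof.
move=> a d e; rewrite /om_defect !add_lfunE !scale_lfunE.
by rewrite linearPl linearPr /= scalerDr addrACA.
Qed.

HB.instance Definition _ x y :=
  GRing.isLinear.Build K 'End(g) K^o *:%R (om_defect x y)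
    (om_defect_linear x y).

Local Notation e i := (vbasis {:g})`_i.

(* The subspace of derivations: by bilinearity the identity need only be
   imposed on pairs of basis vectors, see mem_Der and mem_Der_omega. *)
Definition Der : {vspace gl g} :=
  (\bigcap_(p : 'I_(\dim {:g}) * 'I_(\dim {:g}))
     lker (linfun (der_defect (e p.1) (e p.2))))%VS.

Definition Der_omega : {vspace gl g} :=
  (Der :&: \bigcap_(p : 'I_(\dim {:g}) * 'I_(\dim {:g}))
     lker (linfun (om_defect (e p.1) (e p.2))))%VS.

Lemma mem_bigcap_lker (W : vectType K) (F : g -> g -> 'End(g) -> W)
    (F1 : forall d y, linear (fun x => F x y d))
    (F2 : forall d x, linear (fun y => F x y d)) (f : g -> g -> 'Hom('End(g), W))
    (fE : forall x y d, f x y d = F x y d) (d : 'End(g)) :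
  d \in (\bigcap_(p : 'I_(\dim {:g}) * 'I_(\dim {:g}))
          lker (f (e p.1) (e p.2)))%VS <-> forall x y, F x y d = 0.
Proof.
have linsum (G : g -> W) : linear G ->
    (forall i : 'I_(\dim {:g}), G (e i) = 0) -> forall x, G x = 0.
  move=> Gl G0 x; pose Gm := GRing.isLinear.Build K g W *:%R G Gl.
  pose G' : {linear g -> W} := HB.pack G Gm.
  rewrite -[G x]/(G' x) (coord_vbasis (memvf x)) linear_sum big1 // => i _.
  by rewrite linearZ /= G0 scaler0.
split=> [dD|H].
- have base (i j : 'I_(\dim {:g})) : F (e i) (e j) d = 0.
    move: dD; rewrite memvE => /subv_bigcapP/(_ (i, j) isT).
    by rewrite -memvE memv_ker /= fE => /eqP.
  move=> x y; move: x; apply: (linsum) (F1 d y) _ => i.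
  by move: y; apply: (linsum) (F2 d (e i)) _ => j.
- rewrite memvE; apply/subv_bigcapP => p _.
  by rewrite -memvE memv_ker fE H.
Qed.

Lemma mem_Der (d : 'End(g)) : d \in Der <-> is_derivation d.
Proof.
have -> : is_derivation d <-> forall x y, der_defect x y d = 0.
  split=> H x y; first by rewrite /der_defect H subrr.
  by apply/eqP; rewrite -subr_eq0; apply/eqP/H.
apply: (@mem_bigcap_lker _ der_defect _ _ (fun x y => linfun (der_defect x y)))
  => [d' y a u v|d' x a u v|] /=.
- rewrite /der_defect !linearPl !(linearP d') !linearPl /= scalerBr scalerDr.
  by rewrite [X in _ - X = _]addrACA opprD addrACA.
- rewrite /der_defect !linearPr !(linearP d') !linearPr /= scalerBr scalerDr.
  by rewrite [X in _ - X = _]addrACA opprD addrACA.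
- by move=> x y d'; rewrite lfunE.
Qed.

Lemma mem_Der_omega (d : 'End(g)) :
  d \in Der_omega <-> is_derivation d /\ preserves_om d.
Proof.
have H : d \in (\bigcap_(p : 'I_(\dim {:g}) * 'I_(\dim {:g}))
     lker (linfun (om_defect (e p.1) (e p.2))))%VS <-> preserves_om d.
  apply: (@mem_bigcap_lker _ om_defect _ _ (fun x y => linfun (om_defect x y)))
  => [d' y a u v|d' x a u v|] /=.
  - by rewrite /om_defect (linearP d') !linearPl /= scalerDr addrACA.
  - by rewrite /om_defect (linearP d') !linearPr /= scalerDr addrACA.
  - by move=> x y d'; rewrite lfunE.
by rewrite memv_cap -mem_Der -H; split=> [/andP[]|[-> ->]].
Qed.

Lemma Der_lie_subalgebra : lie_subalgebra Der.
Proof.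
move=> u v /mem_Der Du /mem_Der Dv; apply/mem_Der => x y.
rewrite /= /commutator !(add_lfunE, opp_lfunE, comp_lfunE) Dv Du.
rewrite linearBl linearBr (linearD (u : 'End(g))) (linearD (v : 'End(g))) /= !Du !Dv.
rewrite !opprD !addrA [LHS](ACl (1*5*4*8*(2*7)*(3*6))%AC) /=.
by rewrite !subrr !addr0.
Qed.

End Derivations.

Definition L1_basis (K : fieldType) (g : omegaLieAlg K) (x y z : g) : Prop :=
  [/\ basis_of {:g} [:: x; y; z],
      [/\ obr x z = 0, obr y z = z & obr x y = y] &
      [/\ om y z = 0, om x z = 0 & om x y = 1]].

(* A coordinate model, showing that the hypotheses of L1_basis are
   satisfiable. *)
Section L1Exists.
Variable K : fieldType.
Implicit Types u v w : 'rV[K]_3.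

Let i0 : 'I_3 := @Ordinal 3 0 isT.
Let i1 : 'I_3 := @Ordinal 3 1 isT.
Let i2 : 'I_3 := @Ordinal 3 2 isT.

Let minor u v i j : K := u 0 i * v 0 j - u 0 j * v 0 i.

Definition L1_om u v : K := minor u v i0 i1.

Definition L1_br u v : 'rV[K]_3 :=
  minor u v i0 i1 *: delta_mx 0 i1 + minor u v i1 i2 *: delta_mx 0 i2.

Lemma L1_om_bilinear : bilinear_for *%R *%R L1_om.
Proof. by split=> u a v w /=; rewrite /L1_om /minor !mxE; ring. Qed.

HB.instance Definition _ :=
  bilinear_isBilinear.Build K 'rV[K]_3 'rV[K]_3 K *%R *%R L1_om L1_om_bilinear.

Lemma L1_br_bilinear : bilinear_for *:%R *:%R L1_br.
Proof.
by split=> u a v w /=; apply/rowP => j; rewrite /L1_br /minor !mxE; ring.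
Qed.

HB.instance Definition _ :=
  bilinear_isBilinear.Build K 'rV[K]_3 'rV[K]_3 'rV[K]_3 *:%R *:%R L1_br
    L1_br_bilinear.

Lemma L1_br_skew u v : L1_br u v = - L1_br v u.
Proof. by apply/rowP => j; rewrite /L1_br /minor !mxE; ring. Qed.

Lemma L1_om_skew u v : L1_om u v = - L1_om v u.
Proof. by rewrite /L1_om /minor; ring. Qed.

Lemma L1_jacobi u v w :
  L1_br (L1_br u v) w + L1_br (L1_br v w) u + L1_br (L1_br w u) v
  = L1_om u v *: w + L1_om v w *: u + L1_om w u *: v.
Proof.
apply/rowP; case; case=> [|[|[|//]]] lt3;
  rewrite /L1_br /L1_om /minor !mxE /= (bool_irrelevance lt3 isT);
  by ring.
Qed.

Definition L1_model : omegaLieAlg K :=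
  OmegaLieAlg L1_br_skew L1_om_skew L1_jacobi.

Lemma L1_modelP :
  L1_basis (delta_mx 0 i0 : L1_model) (delta_mx 0 i1) (delta_mx 0 i2).
Proof.
split.
- rewrite basisEdim dimvf /= andbT; apply/subvP => u _.
  rewrite [u]row_sum_delta !big_ord_recl big_ord0 addr0.
  have -> : ord0 = i0 by apply: val_inj.
  have -> : lift i0 ord0 = i1 by apply: val_inj.
  have -> : lift i0 (lift ord0 ord0) = i2 by apply: val_inj.
  rewrite !span_cons span_nil addv0.
  by rewrite !memv_add // memvZ // memv_line.
- by split; apply/rowP => j; rewrite /= /L1_br /minor !mxE /=; ring.
- by split; rewrite /= /L1_om /minor !mxE /=; ring.
Qed.

End L1Exists.

(* Main.v *)
From HB Require Import structures.
Require Import Defs.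
From mathcomp Require Import all_boot all_order all_algebra.
From mathcomp Require Import ring.
From mathcomp Require Import reals.
Local Open Scope ring_scope.

Set Implicit Arguments.
Unset Strict Implicit.
Unset Printing Implicit Defensive.
Import GRing.Theory Num.Theory.

(** In coordinates (p, q, r) along (x, y, z) the bracket of L_1 is the pair of
    minors [u, v] = (p u q v - q u p v) y + (q u r v - r u q v) z.  Comparing
    coefficients in the derivation identity at the three pairs of basis
    vectors forces d x = a z, d y = - a z, d z = c z for some scalars a, c, and
    conversely every such d is a derivation ([L1_is_derivationP]).  So all
    derivations have their image in the line of z: they are the
    combinations a N + c D of the rank-one operators
        N v = (p v - q v) z   and   D v = r v z.
    These are linearly independent, and N z = 0, D z = z give [D, N] = N:
    Der L_1 is the nonabelian Lie algebra of dimension 2.  Its derived algebra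
    is contained in the line of N, which is abelian, hence it is soluble; since
    bracketing with D fixes N, the operator N survives in every term of the
    lower central series, hence it is not nilpotent.

    Finally z spans the radical of omega, so that both omega (d u) v and
    omega u (d v) vanish when d is a derivation, and Der_omega is all of Der.

    Everything works over any field of characteristic different from 2. *)

Section Alternating.
Variables (K : fieldType) (K2 : 2%:R != 0 :> K) (g : omegaLieAlg K).
Implicit Types u : g.

Lemma obr_alt u : obr u u = 0.
Proof.
have /eqP := obr_skew u u.
by rewrite -addr_eq0 -mulr2n -scaler_nat scaler_eq0 (negPf K2) => /eqP.
Qed.

Lemma om_alt u : om u u = 0.
Proof.
have /eqP := om_skew u u.
by rewrite -addr_eq0 -mulr2n -mulr_natl mulf_eq0 (negPf K2) => /eqP.
Qed.

End Alternating.

Section RankOne.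
Variables (K : fieldType) (V : vectType K).
Implicit Types (f h : {scalar V}) (u v : V).

Definition rank_one_fun f u v : V := f v *: u.

Lemma rank_one_fun_linear f u : linear (rank_one_fun f u).
Proof. by move=> a v w; rewrite /rank_one_fun linearP scalerDl scalerA. Qed.

HB.instance Definition _ f u :=
  GRing.isLinear.Build K V V *:%R (rank_one_fun f u) (rank_one_fun_linear f u).

Definition rank_one f u : 'End(V) := linfun (rank_one_fun f u).

Lemma rank_oneE f u v : rank_one f u v = f v *: u.
Proof. by rewrite lfunE. Qed.

(** Both composites factor through the line of u, on which f and h act as the
    scalars f u and h u. *)
Lemma commutator_rank_one f h u :
  commutator (rank_one f u) (rank_one h u)
  = f u *: rank_one h u - h u *: rank_one f u.
Proof.
apply/lfunP => v; rewrite !(add_lfunE, opp_lfunE, scale_lfunE, comp_lfunE).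
rewrite !rank_oneE !scalarZ !scalerA.
by rewrite mulrC [f v * _]mulrC.
Qed.

End RankOne.

Lemma dual_basis3 (K : fieldType) (V : vectType K) (x y z : V) :
  basis_of {:V} [:: x; y; z] ->
  exists p q r : {scalar V},
    (forall v, v = p v *: x + q v *: y + r v *: z) /\
    [/\ [/\ p x = 1, q x = 0 & r x = 0],
        [/\ p y = 0, q y = 1 & r y = 0] &
        [/\ p z = 0, q z = 0 & r z = 1]].
Proof.
move=> Xb; pose X : 3.-tuple V := [tuple x; y; z].
have freeX : free X := basis_free Xb.
pose i0 : 'I_3 := @Ordinal 3 0 isT.
pose i1 : 'I_3 := @Ordinal 3 1 isT.
pose i2 : 'I_3 := @Ordinal 3 2 isT.
exists (coord X i0), (coord X i1), (coord X i2).
split=> [v|]; last first.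
  split; split.
  1-3: by rewrite -[LHS]/(coord X _ X`_i0) coord_free.
  1-3: by rewrite -[LHS]/(coord X _ X`_i1) coord_free.
  1-3: by rewrite -[LHS]/(coord X _ X`_i2) coord_free.
rewrite [LHS](@coord_basis _ _ fullv _ X v Xb (memvf v)).
rewrite !big_ord_recl big_ord0 addr0 addrA.
have -> : lift ord0 (lift ord0 ord0) = i2 by apply: val_inj.
have -> : lift ord0 ord0 = i1 :> 'I_3 by apply: val_inj.
by have -> : ord0 = i0 by apply: val_inj.
Qed.

Section DerivationsOfL1.
Variables (K : fieldType) (K2 : 2%:R != 0 :> K).
Variables (g : omegaLieAlg K) (x y z : g) (hL1 : L1_basis x y z).
Variables p q r : {scalar g}.
Hypothesis expand : forall v, v = p v *: x + q v *: y + r v *: z.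
Hypothesis px : [/\ p x = 1, q x = 0 & r x = 0].
Hypothesis py : [/\ p y = 0, q y = 1 & r y = 0].
Hypothesis pz : [/\ p z = 0, q z = 0 & r z = 1].
Implicit Types (u v w : g) (d : 'End(g)).

Lemma L1_coordE :
  ((p x = 1) * (q x = 0) * (r x = 0) * (p y = 0) * (q y = 1) * (r y = 0)
   * (p z = 0) * (q z = 0) * (r z = 1))%type.
Proof. by case: px; case: py; case: pz. Qed.

Lemma L1_coords v a b c :
  v = a *: x + b *: y + c *: z -> [/\ p v = a, q v = b & r v = c].
Proof.
move=> ->; split; rewrite !linearD !linearZ /= !L1_coordE.
- by rewrite !mulr0 !addr0 mulr1.
- by rewrite !mulr0 add0r addr0 mulr1.
- by rewrite !mulr0 !add0r mulr1.
Qed.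

Lemma L1_obrE u v :
  obr u v = (p u * q v - q u * p v) *: y + (q u * r v - r u * q v) *: z.
Proof.
have [_ [xz yz xy] _] := hL1.
have zx : obr z x = 0 by rewrite obr_skew xz oppr0.
have zy : obr z y = - z by rewrite obr_skew yz.
have yx : obr y x = - y by rewrite obr_skew xy.
rewrite {1}[u]expand {1}[v]expand.
rewrite !(linearDl, linearDr, linearZl_LR, linearZr_LR) /=.
rewrite !(obr_alt K2) xy xz yx yz zx zy !(scalerN, scaler0) !scalerA.
rewrite !(addr0, add0r) scalerBl scalerBl [q u * p v]mulrC [r u * q v]mulrC.
by rewrite [p v * q u]mulrC [q v * r u]mulrC !addrA.
Qed.

Lemma L1_omE u v : om u v = p u * q v - q u * p v.
Proof.
have [_ _ [yz xz xy]] := hL1.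
have zx : om z x = 0 by rewrite om_skew xz oppr0.
have zy : om z y = 0 by rewrite om_skew yz oppr0.
have yx : om y x = - 1 by rewrite om_skew xy.
rewrite {1}[u]expand {1}[v]expand.
rewrite !(linearDl, linearDr, linearZl_LR, linearZr_LR) /=.
by rewrite !(om_alt K2) xy xz yx yz zx zy; ring.
Qed.

(** The nilpotent derivation N and the diagonal derivation D, for which
    [D, N] = N. *)
Definition L1_nil_der : 'End(g) := rank_one (p \- q) z.
Definition L1_diag_der : 'End(g) := rank_one r z.

Lemma L1_der_combE a c v :
  (a *: L1_nil_der + c *: L1_diag_der) v = (a * (p v - q v) + c * r v) *: z.
Proof.
by rewrite add_lfunE !scale_lfunE !rank_oneE /= !scalerA -scalerDl.
Qed.

(** The scalars are a = r (d x) and c = r (d z).  For the other coefficients,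
    the pair (x, y) kills p (d x) and p (d y) and gives r (d y) = - r (d x),
    the pair (x, z) kills q (d x) and q (d z), and the pair (y, z) kills
    q (d y) and p (d z). *)
Lemma L1_is_derivationP d :
  is_derivation d <->
  exists a c, d = a *: L1_nil_der + c *: L1_diag_der.
Proof.
have [_ [xz yz xy] _] := hL1.
pose simp := (mulr0, mulr1, mul0r, mul1r, subr0, sub0r, oppr0, scale0r,
              addr0, add0r).
split=> [H|[a [c ->]] u v]; last first.
  have [pB qB rB] : [/\ p (obr u v) = 0, q (obr u v) = p u * q v - q u * p v
                       & r (obr u v) = q u * r v - r u * q v].
    by apply: L1_coords; rewrite {1}L1_obrE scale0r add0r.
  rewrite !L1_der_combE pB qB rB linearZl_LR linearZr_LR /= !L1_obrE !L1_coordE.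
  by rewrite !simp !scalerA -scalerDl; congr (_ *: z); ring.
have := H x y; rewrite xy L1_obrE L1_obrE !L1_coordE !simp => Hxy.
have := H x z; rewrite xz linear0 L1_obrE L1_obrE !L1_coordE !simp => Hxz.
have := H y z; rewrite yz L1_obrE L1_obrE !L1_coordE !simp => Hyz.
have [pdy qdy rdy] : [/\ p (d y) = 0, q (d y) = p (d x) + q (d y)
                       & r (d y) = - r (d x)].
  by apply: L1_coords; rewrite {1}Hxy scale0r add0r scalerDl addrAC.
have [_ qdz qdx] : [/\ p 0 = 0, q 0 = q (d z) & r 0 = q (d x)].
  by apply: L1_coords; rewrite {1}Hxz scale0r add0r addrC.
have [pdz _ rdz] : [/\ p (d z) = 0, q (d z) = - p (d z)
                     & r (d z) = q (d y) + r (d z)].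
  by apply: L1_coords; rewrite {1}Hyz scale0r add0r scalerDl addrCA.
rewrite linear0 in qdz; rewrite linear0 in qdx.
have pdx : p (d x) = 0 by apply: (addIr (q (d y))); rewrite -qdy add0r.
have {}qdy : q (d y) = 0 by apply: (addIr (r (d z))); rewrite -rdz add0r.
exists (r (d x)), (r (d z)); apply/lfunP => v; rewrite L1_der_combE.
rewrite {1}[v]expand !linearD !linearZ /= {1}[d x]expand {1}[d y]expand.
rewrite {1}[d z]expand -qdx pdx pdy qdy pdz -qdz rdy !simp.
by rewrite !scalerA -!scalerDl; congr (_ *: _); ring.
Qed.

Lemma L1_DerE : Der g = <<[:: L1_nil_der; L1_diag_der]>>%VS.
Proof.
apply/vspaceP => d; rewrite span_cons span_seq1; apply/idP/idP.
  move=> /mem_Der/L1_is_derivationP[a [c ->]].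
  by rewrite memv_add // memvZ ?memv_line.
move=> /memv_addP[_ /vlineP[a ->] [_ /vlineP[c ->] ->]].
by apply/mem_Der/L1_is_derivationP; exists a, c.
Qed.

Let z_neq0 : z != 0.
Proof.
have [_ _ rz] := pz.
by apply: contra_neq (oner_neq0 K) => z0; rewrite -rz z0 linear0.
Qed.

Lemma L1_nil_der_x : L1_nil_der x = z.
Proof. by rewrite rank_oneE /= !L1_coordE subr0 scale1r. Qed.

Lemma L1_diag_der_x : L1_diag_der x = 0.
Proof. by rewrite rank_oneE L1_coordE scale0r. Qed.

Lemma L1_diag_der_z : L1_diag_der z = z.
Proof. by rewrite rank_oneE L1_coordE scale1r. Qed.

Lemma L1_nil_der_neq0 : L1_nil_der != 0.
Proof.
by apply: contraNneq z_neq0 => D0; rewrite -L1_nil_der_x D0 lfunE.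
Qed.

Lemma L1_dim_Der : \dim (Der g) = 2%N.
Proof.
suff /eqP : free [:: L1_nil_der; L1_diag_der] by rewrite L1_DerE.
rewrite free_cons span_seq1 seq1_free; apply/andP; split.
  apply/vlineP => -[k Dk]; have /eqP := L1_nil_der_x.
  by rewrite Dk scale_lfunE L1_diag_der_x scaler0 eq_sym (negPf z_neq0).
by apply: contraNneq z_neq0 => D0; rewrite -L1_diag_der_z D0 lfunE.
Qed.

(** The relation that governs both the derived and the lower central series. *)
Lemma L1_commutator : commutator L1_diag_der L1_nil_der = L1_nil_der.
Proof.
by rewrite commutator_rank_one /= !L1_coordE subr0 scale0r scale1r subr0.
Qed.

Lemma L1_derived_Der : (lie_prod (Der g) (Der g) <= <[L1_nil_der : gl g]>)%VS.
Proof.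
apply/(@lie_prodP _ (gl g)) => u w.
rewrite L1_DerE span_cons span_seq1.
move=> /memv_addP[_ /vlineP[a ->] [_ /vlineP[c ->] ->]].
move=> /memv_addP[_ /vlineP[a' ->] [_ /vlineP[c' ->] ->]].
rewrite !(linearDl, linearDr, linearZl_LR, linearZr_LR) /=.
rewrite !commutator_alt L1_commutator.
have -> : commutator L1_nil_der L1_diag_der = - L1_nil_der.
  by rewrite -[in RHS]L1_commutator /commutator opprB.
by rewrite !(memvD, memvZ, memvN, mem0v, memv_line).
Qed.

Lemma L1_Der_soluble : soluble (Der g).
Proof.
exists 2%N; apply/eqP; rewrite -subv0; apply/lie_prodP => u w.
move=> /(subvP L1_derived_Der)/vlineP[a ->].
move=> /(subvP L1_derived_Der)/vlineP[b ->].
by rewrite linearZl_LR linearZr_LR /= commutator_alt !scaler0 mem0v.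
Qed.

Lemma L1_Der_not_nilpotent : ~ nilpotent (Der g).
Proof.
have memD : {subset [:: L1_nil_der; L1_diag_der] <= Der g}.
  by rewrite L1_DerE; apply: memv_span.
have D1 k : (L1_nil_der : gl g) \in lower_central_series (Der g) k.
  elim: k => [|k IHk]; first by apply: memD; rewrite mem_head.
  rewrite -[L1_nil_der]L1_commutator; apply: mem_lie_prod => //.
  by apply: memD; rewrite !inE eqxx orbT.
case=> k Dk; have := D1 k; rewrite Dk memv0.
exact/negP/L1_nil_der_neq0.
Qed.

(** The values of a derivation are multiples of z, which is orthogonal to
    everything for omega. *)
Lemma L1_Der_omega : Der_omega g = Der g.
Proof.
apply/vspaceP => d; apply/idP/idP => [/mem_Der_omega[/mem_Der]//|Dd].
apply/mem_Der_omega; split=> [|u v]; first exact/mem_Der.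
have /mem_Der/L1_is_derivationP[a [c ->]] := Dd.
rewrite !L1_der_combE !L1_omE !linearZ /= !L1_coordE.
by rewrite !mulr0 !mul0r !subr0 addr0.
Qed.

End DerivationsOfL1.

(* R[i] for a realType R is the field of complex numbers. *)
Theorem proposition3p1 (R : realType) (L1 : omegaLieAlg R[i]) (x y z : L1)
    (hL1 : L1_basis x y z) :
  [/\ lie_subalgebra (Der L1), \dim (Der L1) = 2%N,
      soluble (Der L1) & ~ nilpotent (Der L1)]
  /\ Der_omega L1 = Der L1.
Proof.
have C2 : 2%:R != 0 :> R[i] by rewrite pnatr_eq0.
have [Xb _ _] := hL1.
have [p [q [r [expand [px py pz]]]]] := dual_basis3 Xb.
split; last exact: (L1_Der_omega C2 hL1 expand px py pz).
split; first exact: Der_lie_subalgebra.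
- exact: (L1_dim_Der C2 hL1 expand px py pz).
- exact: (L1_Der_soluble C2 hL1 expand px py pz).
- exact: (L1_Der_not_nilpotent C2 hL1 expand px py pz).
Qed.
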